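(* Let $d$ and $\Delta$ be integers with $2\le d\le\Delta$, and let $G$ be a finite simple $d$-degenerate graph with maximum degree $\Delta(G)\le\Delta$. If $q_B(G)=d\Delta-1$, then there are sets $X,Y\subseteq V(G)$ and a vertex $u^*\notin X$ such that $|X|=d-1$, $|Y|=\Delta$, $N_G(x)=Y$ for every $x\in X$, and $$|Y\setminus N_G(u^* )|=1,\qquad |N_G(u^* )\setminus Y|\le1.$$ Thus $X$ is a set of pairwise false twins, each of degree $\Delta$. In particular, $G$ contains a copy of $K_{d,\Delta-1}$.
   Context: A $B$-coloring of a graph $G$ is a proper edge-coloring (incident edges receive distinct colors) in which the edges of every $4$-cycle receive four distinct colors; $q_B(G)$ is the minimum number of colors in a $B$-coloring of $G$. A graph is $d$-degenerate if every nonempty subgraph has a vertex of degree at most $d$ (in that subgraph). ''Contains a copy of $K_{a,b}$'' means contains a subgraph, not necessarily induced, isomorphic to the complete bipartite graph $K_{a,b}$. $N_G(x)$ is the open neighborhood of $x$ and $\Delta(G)$ the maximum degree of $G$. Two distinct vertices are false twins if they have the same open neighborhood. *)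

(* Defs.v *)
From mathcomp Require Import all_boot.

Set Implicit Arguments.
Unset Strict Implicit.
Unset Printing Implicit Defensive.

(* A finite simple graph is a symmetric irreflexive relation [e] on the finite
   type [T] of its vertices; the definitions below take [e] and the theorem
   assumes both properties. *)

Definition neigh (T : finType) (e : rel T) (x : T) : {set T} :=
  [set y | e x y].

Definition deg (T : finType) (e : rel T) (x : T) : nat := #|neigh e x|.

Definition max_deg (T : finType) (e : rel T) : nat := \max_(x : T) deg e x.

Definition false_twins (T : finType) (e : rel T) (x y : T) : Prop :=
  x != y /\ neigh e x = neigh e y.

(* (S, f) is a subgraph of (T, e), not necessarily induced. *)
Definition subgraph (T : finType) (S : {set T}) (f e : rel T) : Prop :=
  symmetric f /\ (forall x y, f x y -> [/\ x \in S, y \in S & e x y]).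

Definition degenerate (T : finType) (d : nat) (e : rel T) : Prop :=
  forall (S : {set T}) (f : rel T), subgraph S f e -> S != set0 ->
  exists2 x, x \in S & deg f x <= d.

Definition contains_copy (U T : finType) (h : rel U) (e : rel T) : Prop :=
  exists2 f : U -> T, injective f & forall u v, h u v -> e (f u) (f v).

Definition complete_bipartite (a b : nat) : rel ('I_a + 'I_b) :=
  fun u v => match u, v with
             | inl _, inr _ | inr _, inl _ => true
             | _, _ => false
             end.
Arguments complete_bipartite a b : clear implicits.

Definition edges (T : finType) (e : rel T) : {set {set T}} :=
  [set f | [exists x, exists y, e x y && (f == [set x; y])]].

(* Colors are assigned to actual edges only, so that an edgeless graph has a
   coloring with 0 colors. *)
Definition edge (T : finType) (e : rel T) : finType :=
  {f : {set T} | f \in edges e}.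

Definition cycle4_edges (T : finType) (x y z w : T) : {set {set T}} :=
  [set [set x; y]; [set y; z]; [set z; w]; [set w; x]].

Definition proper_edge_coloring (T : finType) (e : rel T) (k : nat)
    (c : {ffun edge e -> 'I_k}) : bool :=
  [forall f : edge e, forall g : edge e,
    (f != g) && (val f :&: val g != set0) ==> (c f != c g)].

Definition rainbow_4cycles (T : finType) (e : rel T) (k : nat)
    (c : {ffun edge e -> 'I_k}) : bool :=
  [forall x, forall y, forall z, forall w,
    ucycleb e [:: x; y; z; w] ==>
    [forall f : edge e, forall g : edge e,
      [&& val f \in cycle4_edges x y z w, val g \in cycle4_edges x y z w
        & f != g] ==> (c f != c g)]].

Definition B_coloring (T : finType) (e : rel T) (k : nat)
    (c : {ffun edge e -> 'I_k}) : bool :=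
  proper_edge_coloring c && rainbow_4cycles c.

Definition B_colorable (T : finType) (e : rel T) (k : nat) : bool :=
  [exists c : {ffun edge e -> 'I_k}, B_coloring c].

Lemma B_colorable_exists (T : finType) (e : rel T) :
  exists k, B_colorable e k.
Proof.
exists #|edge e|; apply/existsP; exists [ffun f => enum_rank f].
apply/andP; split.
  apply/forallP=> f; apply/forallP=> g; apply/implyP=> /andP[fg _].
  by rewrite !ffunE (inj_eq enum_rank_inj).
apply/forallP=> x; apply/forallP=> y; apply/forallP=> z; apply/forallP=> w.
apply/implyP=> _; apply/forallP=> f; apply/forallP=> g.
by apply/implyP=> /and3P[_ _ fg]; rewrite !ffunE (inj_eq enum_rank_inj).
Qed.

Definition qB (T : finType) (e : rel T) : nat :=
  ex_minn (B_colorable_exists e).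

(* Main.v *)
(** Delete a vertex [v] of minimum degree [r <= d] and color the rest.  Adding [v]
   back creates no conflict between old edges, so only the edges at [v] need
   colors.  Writing [P x] for [N(x)] without [v], the edge [vx] sees at most
   [m x = \sum_(y in N(v)) #|P x :&: P y| <= r (Delta - 1)] old colors, so with
   [d * Delta - 2] colors a greedy extension succeeds unless [r = d] and either
   some [m x] is maximal or every [m x] is maximal minus one.  In the first case
   all neighborhoods of neighbors of [v] agree, which gives a [K_{d,Delta}] and
   forces [d * Delta] colors.  In the second case the [P x] are pairwise equal up
   to one exception for each [x], which forces [d = 2] and the two neighbors of
   [v] are the required [x] and [u].  In particular [d = 2] whenever
   [qB e = d * Delta - 1]. *)

Require Import Defs.
From mathcomp Require Import all_boot.
From mathcomp Require Import zify.

Set Implicit Arguments.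
Unset Strict Implicit.
Unset Printing Implicit Defensive.

(** * Colorings as symmetric functions on pairs of vertices *)

(** Kept on the type [T], with the vertices outside [S] isolated, so that induction on [S] never
    changes the vertex type. *)
Definition induced (T : finType) (S : {set T}) (e : rel T) : rel T :=
  [rel x y | [&& x \in S, y \in S & e x y]].

(** Only opposite edges of a 4-cycle are compared, since properness separates adjacent ones. Values
    on non-edges are free up to symmetry. *)
Definition pair_coloring (T : finType) (e : rel T) (k : nat)
    (c : T -> T -> nat) : Prop :=
  [/\ forall x y, c x y = c y x,
      forall x y, e x y -> c x y < k,
      forall x y z, e x y -> e x z -> y != z -> c x y != c x z
    & forall x y z w, e x y -> e y z -> e z w -> e w x -> x != z -> y != w ->
        c x y != c z w].

Lemma eq_set2 (T : finType) (x y a b : T) :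
  [set x; y] = [set a; b] -> x = a /\ y = b \/ x = b /\ y = a.
Proof.
move=> E.
have /set2P xab : x \in [set a; b] by rewrite -E set21.
have /set2P yab : y \in [set a; b] by rewrite -E set22.
have /set2P axy : a \in [set x; y] by rewrite E set21.
have /set2P bxy : b \in [set x; y] by rewrite E set22.
case: xab yab axy bxy => -> [] ->; try (by left); try (by right).
- by move=> _ [] ->; left.
- by move=> [] -> _; left.
Qed.

Lemma edgesP (T : finType) (e : rel T) (f : {set T}) :
  reflect (exists2 p : T * T, e p.1 p.2 & f = [set p.1; p.2]) (f \in edges e).
Proof.
rewrite inE; apply: (iffP existsP) => [[x /existsP[y /andP[exy /eqP->]]]|].
  by exists (x, y).
by case=> [[x y] /= exy ->]; exists x; apply/existsP; exists y; rewrite exy /=.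
Qed.

Lemma edge_at (T : finType) (e : rel T) (f : {set T}) (x : T) :
  symmetric e -> f \in edges e -> x \in f -> exists2 y, e x y & f = [set x; y].
Proof.
move=> e_sym /edgesP[[a b] /= eab ->] /set2P[] ->; first by exists b.
by exists a; rewrite 1?e_sym // setUC.
Qed.

Lemma B_colorable_pair_coloring (T : finType) (e : rel T) (k : nat) :
  irreflexive e -> B_colorable e k -> exists c, pair_coloring e k c.
Proof.
move=> e_irr /existsP[c /andP[/forallP cP /forallP cR]].
pose g x y := if insub [set x; y] is Some f then c f : nat else 0.
have edgeE x y : e x y -> {f : edge e | val f = [set x; y] & g x y = c f}.
  move=> exy; have fe : [set x; y] \in edges e by apply/edgesP; exists (x, y).
  exists (exist (fun f => f \in edges e) _ fe); first by [].
  by rewrite /g insubT.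
have neq x y : e x y -> x != y by move=> exy; apply: contraTneq exy => ->; rewrite e_irr.
exists g; split=> [x y|x y exy|x y z exy exz yz|x y z w exy eyz ezw ewx xz yw].
- by rewrite /g setUC.
- by have [f _ ->] := edgeE _ _ exy; apply: ltn_ord.
- have [f fE ->] := edgeE _ _ exy; have [f' f'E ->] := edgeE _ _ exz.
  have /forallP/(_ f')/implyP := cP f; apply.
  apply/andP; split.
    apply: contra yz => /eqP ff'; have := fE; rewrite ff' f'E.
    by case/eq_set2=> [[_ ->]|[-> ->]].
  by apply/set0Pn; exists x; rewrite fE f'E !inE eqxx.
have [f fE ->] := edgeE _ _ exy; have [f' f'E ->] := edgeE _ _ ezw.
have /forallP/(_ y)/forallP/(_ z)/forallP/(_ w)/implyP R := cR x.
have {}/R/forallP/(_ f)/forallP/(_ f')/implyP : ucycleb e [:: x; y; z; w].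
  rewrite /ucycleb /= exy eyz ezw ewx !inE !negb_or xz yw (neq _ _ exy) (neq _ _ eyz).
  by rewrite (neq _ _ ezw) eq_sym (neq _ _ ewx).
apply; rewrite fE f'E !inE !eqxx /= !orbT /=; apply: contra xz => /eqP ff'.
have := fE; rewrite ff' f'E => /eq_set2[[-> _]|[_ wx]] //.
by move: ewx; rewrite wx e_irr.
Qed.

Lemma pair_coloring_B_colorable (T : finType) (e : rel T) (k : nat) c :
  symmetric e -> pair_coloring e k c -> B_colorable e k.
Proof.
move=> e_sym [c_sym c_lt c_prop c_C4].
(* An edge is an unordered pair; symmetry of [c] makes its color independent of the order in which
   the ends are read. *)
have /fin_all_exists[g gE] (f : edge e) : exists i : 'I_k,
    forall x y, val f = [set x; y] -> i = c x y :> nat.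
  have /edgesP[[a b] /= eab fE] := valP f.
  exists (Ordinal (c_lt _ _ eab)) => x y; rewrite fE.
  by case/eq_set2=> -[<- <-] /=.
have g_prop (f f' : edge e) : f != f' -> val f :&: val f' != set0 -> g f != g f'.
  move=> ff' /set0Pn[x /setIP[xf xf']].
  have [y exy fE] := edge_at e_sym (valP f) xf.
  have [z exz f'E] := edge_at e_sym (valP f') xf'.
  rewrite -val_eqE /= (gE _ _ _ fE) (gE _ _ _ f'E); apply: c_prop => //.
  by apply: contra ff' => /eqP yz; rewrite -val_eqE fE f'E yz.
apply/existsP; exists [ffun f => g f]; apply/andP; split.
  apply/forallP=> f; apply/forallP=> f'; apply/implyP=> /andP[ff' I].
  by rewrite !ffunE g_prop.
apply/forallP=> x; apply/forallP=> y; apply/forallP=> z; apply/forallP=> w.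
apply/implyP=> /andP[/= /and5P[exy eyz ezw ewx _]].
rewrite !inE !negb_or => /and4P[/and3P[xy xz xw] /andP[yz yw] zw _].
apply/forallP=> f; apply/forallP=> f'; apply/implyP=> /and3P[fC f'C ff'].
rewrite !ffunE; have [D|] := eqVneq (val f :&: val f') set0; last exact: g_prop.
have dis a A B : val f = A -> val f' = B -> a \in A -> a \in B -> False.
  by move=> <- <- af af'; have := in_set0 a; rewrite -D inE af af'.
have C1 := c_C4 _ _ _ _ exy eyz ezw ewx xz yw.
have C2 := c_C4 _ _ _ _ eyz ezw ewx exy yw.
rewrite eq_sym in xz; have {}C2 := C2 xz.
move: fC f'C; rewrite !inE -!orbA.
(* Opposite edges fall under [C1] or [C2]; any other pair shares a vertex, against [D]. *)
move=> /or4P[] /eqP fE /or4P[] /eqP f'E; rewrite -val_eqE /= (gE _ _ _ fE) (gE _ _ _ f'E) //;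
  try (by rewrite eq_sym);
  by [case: (dis x _ _ fE f'E); rewrite !inE eqxx ?orbT
     |case: (dis y _ _ fE f'E); rewrite !inE eqxx ?orbT
     |case: (dis z _ _ fE f'E); rewrite !inE eqxx ?orbT
     |case: (dis w _ _ fE f'E); rewrite !inE eqxx ?orbT].
Qed.

(** * Greedy extension to a deleted vertex *)

(** Following the order of [s], the element after the prefix [t] must avoid [F x] and [size t]
    earlier colors, fewer than [k] in all. *)
Lemma greedy_colors (T : eqType) (s : seq T) (F : T -> seq nat) (k : nat) :
  uniq s ->
  (forall t x u, s = t ++ x :: u -> size (F x) + size t < k) ->
  exists g : T -> nat, {in s &, injective g} /\
    (forall x, x \in s -> g x < k /\ g x \notin F x).
Proof.
elim/last_ind: s => [|s x IH]; first by exists (fun=> 0).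
rewrite rcons_uniq => /andP[xs us] sk.
have [|g [g_inj gP]] := IH us.
  by move=> t y u sE; apply: (sk t y (rcons u x)); rewrite sE rcons_cat.
have [a ak aF] : exists2 a, a < k & a \notin F x ++ map g s.
  have /allPn[a] : ~~ all [in F x ++ map g s] (iota 0 k).
    apply/negP=> /allP /(uniq_leq_size (iota_uniq 0 k)).
    rewrite size_iota size_cat size_map => le.
    by have := sk s x [::]; rewrite cats1 => /(_ erefl); rewrite ltnNge le.
  by rewrite mem_iota => ak aF; exists a.
move: aF; rewrite mem_cat negb_or => /andP[aF ag].
exists (fun y => if y == x then a else g y); split.
  move=> y z; rewrite !mem_rcons !inE.
  case: eqP => [->|_] /=; case: eqP => [->|_] //= ys zs.
  - by move=> aE; rewrite aE map_f in ag.
  - by move=> aE; rewrite -aE map_f in ag.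
  - exact: g_inj.
move=> y; rewrite mem_rcons inE; case: eqP => [->|_] //=; exact: gP.
Qed.

Section Extension.

Variables (T : finType) (e : rel T) (S : {set T}) (v : T).
Hypotheses (e_sym : symmetric e) (e_irr : irreflexive e).

Let h := induced S e.
Let N := neigh h v.
Let P x := neigh h x :\ v.

(* The term [y = x] of the sum counts the old edges at [x]; the term [y != x]
   counts the edges [yz] opposite to [vx] in a 4-cycle [v x z y]. *)
Lemma extend_pair_coloring (k : nat) (s : seq T) c :
  pair_coloring (induced (S :\ v) e) k c ->
  uniq s -> s =i N ->
  (forall t x u, s = t ++ x :: u ->
     \sum_(y in N) #|P x :&: P y| + size t < k) ->
  exists c', pair_coloring h k c'.
Proof.
case=> c_sym c_lt c_prop c_C4 us sN sk.
(* Repetitions are kept, so the size of [F x] is exactly the sum in the hypothesis. *)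
pose F x := flatten [seq [seq c y z | z <- enum (P x :&: P y)] | y <- enum N].
have mem_F x y z : h v y -> h x z -> h y z -> z != v -> c y z \in F x.
  move=> vy xz yz zv; apply/flatten_mapP; exists y.
    by rewrite mem_enum inE.
  by rewrite map_f // mem_enum !inE zv xz yz.
have size_F x : size (F x) = \sum_(y in N) #|P x :&: P y|.
  rewrite size_flatten /shape -map_comp sumnE big_map -big_enum /=.
  by apply: eq_bigr => y _; rewrite size_map -cardE.
have [|g [g_inj gP]] := @greedy_colors _ s F k us.
  by move=> t x u sE; rewrite size_F; apply: sk sE.
have hsym x y : h x y = h y x by rewrite /h /induced /= e_sym andbCA.
have hirr x y : h x y -> x != y.
  by apply: contraTneq => ->; rewrite /h /induced /= e_irr !andbF.
have del x y : h x y -> x != v -> y != v -> induced (S :\ v) e x y.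
  by rewrite /h /induced /= !inE => /and3P[-> -> ->] -> ->.
have in_s x : h v x -> x \in s by rewrite sN inE.
have gF x y z : h v x -> h v y -> h x z -> h y z -> z != v -> g x != c y z.
  move=> vx vy xz yz zv; have [_] := gP _ (in_s _ vx).
  by apply: contraNneq => ->; apply: mem_F.
exists (fun x y => if x == v then g y else if y == v then g x else c x y).
split=> [x y|x y xy|x y z xy xz yz|x y z w xy yz zw wx xz yw] /=.
- by case: (eqVneq x v) => [->|_]; case: (eqVneq y v) => [E|_]; rewrite ?E.
- case: eqP xy => [->|/eqP xv] xy; first by have [] := gP _ (in_s _ xy).
  case: eqP xy => [->|/eqP yv] xy; last exact/c_lt/del.
  by rewrite hsym in xy; have [] := gP _ (in_s _ xy).
- case: (eqVneq x v) xy xz => [->|xv] xy xz.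
    by apply: contra yz => /eqP gyz; apply/eqP/g_inj => //; apply: in_s.
  case: (eqVneq y v) xy yz => [->|yv] xy yz.
    by rewrite [z == v]eq_sym (negPf yz) gF // 1?hsym // eq_sym.
  case: (eqVneq z v) xz yz => [->|zv] xz yz; last by apply: c_prop; rewrite ?del.
    by rewrite eq_sym gF // 1?hsym.
have xy' := xy; have yz' := yz; have zw' := zw; have wx' := wx.
rewrite hsym in xy'; rewrite hsym in yz'; rewrite hsym in zw'; rewrite hsym in wx'.
have nx := hirr _ _ xy; have ny := hirr _ _ yz.
have nz := hirr _ _ zw; have nw := hirr _ _ wx.
(* A 4-cycle through [v] has exactly one edge of each opposite pair at [v]; the color of the other
   edge lies in the list that [g] avoids there. *)
have [xv|xv] := eqVneq x v.
  by rewrite -xv [z == x]eq_sym (negPf xz) (negPf nw) c_sym gF -?xv // eq_sym.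
have [yv|yv] := eqVneq y v.
  by rewrite -yv eq_sym in ny *; rewrite (negPf ny) [w == y]eq_sym (negPf yw) gF -?yv // eq_sym.
have [zv|zv] := eqVneq z v.
  by rewrite eq_sym c_sym gF -?zv.
have [wv|wv] := eqVneq w v.
  by rewrite eq_sym gF -?wv.
by apply: c_C4; rewrite ?del.
Qed.

End Extension.

(** * Set families with large pairwise intersections *)

(** Each index in [A] loses at least one unit from the bound [b], so a sum close to [#|N| * b] has
    few short terms. *)
Lemma sum_defect (T : finType) (N A : {set T}) (F : T -> nat) (b : nat) :
  A \subset N -> {in N, forall x, F x <= b} -> {in A, forall x, F x < b} ->
  \sum_(x in N) F x + #|A| <= #|N| * b.
Proof.
move=> AN Fb FA; have -> : #|A| = \sum_(x in N) (x \in A).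
  rewrite -sum1_card big_mkcond [RHS]big_mkcond; apply: eq_bigr => x _.
  by have [/(subsetP AN) ->|] := boolP (x \in A); last case: ifP.
rewrite -sum_nat_const -big_split; apply: leq_sum => x xN /=.
by have [/FA|_] := boolP (x \in A); rewrite ?addn1 ?addn0 ?Fb.
Qed.

Section Family.

Variables (T : finType) (N : {set T}) (P : T -> {set T}) (b : nat).
Hypothesis P_le : {in N, forall x, #|P x| <= b}.

Let m x := \sum_(y in N) #|P x :&: P y|.

Let I_le x : x \in N -> {in N, forall y, #|P x :&: P y| <= b}.
Proof.
by move=> xN y yN; apply: leq_trans (P_le xN); apply/subset_leq_card/subsetIl.
Qed.

Lemma eq_of_full_meet x y : x \in N -> y \in N -> b <= #|P x :&: P y| ->
  #|P x| = b /\ P y = P x.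
Proof.
move=> xN yN bI.
have Ex : P x :&: P y = P x.
  by apply/eqP; rewrite eqEcard subsetIl (leq_trans _ bI) ?P_le.
have Ey : P x :&: P y = P y.
  by apply/eqP; rewrite eqEcard subsetIr (leq_trans _ bI) ?P_le.
split; last by rewrite -Ey.
by apply/eqP; rewrite eqn_leq P_le //= -Ex.
Qed.

(** No term of the sum can be short, so each [P y] meets [P x] in [b] elements, which exhausts both
    sets. *)
Lemma family_full x : x \in N -> #|N| * b <= m x ->
  #|P x| = b /\ {in N, forall y, P y = P x}.
Proof.
move=> xN full.
have I_ge y : y \in N -> b <= #|P x :&: P y|.
  move=> yN; rewrite leqNgt; apply/negP=> lt.
  have := @sum_defect _ N [set y] (fun y => #|P x :&: P y|) b.
  rewrite sub1set cards1 -/(m x) => /(_ yN (I_le xN)) H.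
  suff : m x + 1 <= #|N| * b by lia.
  by apply: H => z /set1P ->.
split; first by have [] := eq_of_full_meet xN xN (I_ge _ xN).
by move=> y yN; have [] := eq_of_full_meet xN yN (I_ge _ yN).
Qed.

(* Each [x] has total defect exactly 1, so its [P]-class misses exactly one
   member of [N]; comparing two different classes leaves only [#|N| = 2]. *)
Lemma family_near_full : 1 < #|N| -> {in N, forall x, #|N| * b = (m x).+1} ->
  exists x y, [/\ N = [set x; y], x != y, #|P x| = b, #|P y| = b
    & #|P x :&: P y|.+1 = b].
Proof.
move=> N_gt1 near.
(* A smaller [P x] would make all [#|N| >= 2] terms short, while the total defect is 1. *)
have meetxx x : x \in N -> #|P x| = b.
  move=> xN; apply/eqP; rewrite eqn_leq P_le //= leqNgt; apply/negP=> lt.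
  have := @sum_defect _ N N (fun y => #|P x :&: P y|) b (subxx _) (I_le xN).
  rewrite -/(m x) (near x xN) => H; suff : m x + #|N| <= (m x).+1 by lia.
  by apply: H => y yN; apply: leq_ltn_trans lt; apply/subset_leq_card/subsetIl.
have two x y z : x \in N -> y \in N -> z \in N -> y != z -> P y != P x -> P z = P x.
  move=> xN yN zN yz yx; apply/eqP/negPn/negP=> zx.
  have lt u : u \in N -> P u != P x -> #|P x :&: P u| < b.
    move=> uN; apply: contraNT; rewrite -leqNgt => le; apply/eqP.
    by have [] := eq_of_full_meet xN uN le.
  have := @sum_defect _ N [set y; z] (fun y => #|P x :&: P y|) b _ (I_le xN).
  rewrite -/(m x) (near x xN) cards2 yz subUset !sub1set yN zN => /(_ isT) H.
  suff : m x + 2 <= (m x).+1 by lia.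
  by apply: H => u /set2P[] ->; apply: lt.
have [x xN] : exists x, x \in N by apply/set0Pn; rewrite -card_gt0; lia.
have [y yN yx] : exists2 y, y \in N & P y != P x.
  have [/exists_inP //|/exists_inPn H] := boolP [exists y in N, P y != P x].
  have : m x = #|N| * b; last by have := near _ xN; lia.
  rewrite -sum_nat_const; apply: eq_bigr => y yN.
  by have /negPn/eqP -> := H y yN; rewrite setIid meetxx.
have xy : x != y by apply: contraNneq yx => ->.
have NE : N = [set x; y].
  apply/setP=> z; rewrite !inE; apply/idP/orP=> [zN|[]/eqP -> //].
  (* A third index [z] would have [P z = P x], as [y] is the exception for [x], and [P z = P y], as
     [x] is the exception for [y]. *)
  have [_|zx] := eqVneq z x; first by left.
  have [_|zy] := eqVneq z y; first by right.
  have Pzx : P z = P x by apply: (two x y z) => //; rewrite eq_sym.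
  have : P z = P y by apply: (two y x z); rewrite // eq_sym.
  by move/eqP; rewrite Pzx eq_sym (negPf yx).
exists x, y; split; rewrite ?meetxx //.
have := near x xN; rewrite /m NE big_setU1 ?inE //= big_set1 cards2 xy.
by rewrite setIid meetxx //; lia.
Qed.

End Family.

(** * Induction on the vertex set *)

Section Dichotomy.

Variables (d Delta : nat) (T : finType) (e : rel T).
Hypotheses (e_sym : symmetric e) (e_irr : irreflexive e).
Hypotheses (d_ge2 : 2 <= d) (d_le_Delta : d <= Delta).
Hypotheses (e_degenerate : degenerate d e) (e_max_deg : max_deg e <= Delta).

(** A vertex that already has [Delta] neighbors inside [S] has none outside, so what is found in an
    induced subgraph holds in [e]. *)
Lemma neigh_induced_eq (S : {set T}) (x : T) :
  #|neigh (induced S e) x| = Delta -> neigh e x = neigh (induced S e) x.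
Proof.
move=> E; apply/esym/eqP; rewrite eqEcard E; apply/andP; split.
  by apply/subsetP=> y; rewrite !inE => /and3P[].
by apply: leq_trans e_max_deg; apply: leq_bigmax.
Qed.

(** The last two alternatives speak of [e] alone, so they pass from [S :\ v] to [S] unchanged; only
    a coloring has to be extended. *)
Lemma induced_colorable_or (S : {set T}) :
  [\/ exists c, pair_coloring (induced S e) (d * Delta - 2) c,
      exists N Y : {set T},
        [/\ #|N| = d, #|Y| = Delta & {in N, forall w, neigh e w = Y}]
    | d = 2 /\ exists w u,
        [/\ w != u, #|neigh e w| = Delta, #|neigh e u| = Delta
          & #|neigh e w :&: neigh e u|.+1 = Delta]].
Proof.
have [n] := ubnP #|S|; elim: n S => // n IH S Sn.
have [->|S0] := eqVneq S set0.
  by apply: Or31; exists (fun _ _ => 0); split=> // x y; rewrite /induced /= in_set0.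
set h := induced S e.
have h_sym : symmetric h by move=> x y; rewrite /h /induced /= e_sym andbCA.
have h_sub : subgraph S h e by split=> // x y /and3P[].
have [v vS dv] := e_degenerate h_sub S0.
have Sv : #|S :\ v| < n by rewrite (cardsD1 v) vS in Sn.
have [[c c_col]|H|H] := IH _ Sv; [|exact: Or32|exact: Or33].
set N := neigh h v in dv; pose P x := neigh h x :\ v.
have hP x : x \in N -> neigh h x = v |: P x.
  by rewrite inE h_sym => xv; rewrite setD1K // inE.
have h_deg x : x \in N -> #|neigh h x| = #|P x|.+1.
  by move=> xN; rewrite hP // cardsU1 !inE eqxx.
have h_le x : #|neigh h x| <= Delta.
  apply: leq_trans e_max_deg; apply: leq_trans (leq_bigmax x).
  by apply/subset_leq_card/subsetP=> y; rewrite !inE => /and3P[].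
have P_le : {in N, forall x, #|P x| <= Delta.-1}.
  by move=> x xN; have := h_le x; rewrite h_deg //; lia.
pose m x := \sum_(y in N) #|P x :&: P y|.
have m_le x : x \in N -> m x <= #|N| * Delta.-1.
  move=> xN; rewrite -sum_nat_const; apply: leq_sum => y yN.
  by apply: leq_trans (P_le x xN); apply/subset_leq_card/subsetIl.
have ext := extend_pair_coloring e_sym e_irr c_col.
(* At most [#|N| * Delta - 1 <= (d - 1) * Delta - 1] colors are forbidden, below [d * Delta - 2]
   because [Delta >= 2]. *)
have [dN|dN] := ltnP #|N| d.
  apply: Or31; apply: (ext (enum N)) (enum_uniq _) (mem_enum _) _ => t x u tE.
  have xN : x \in N by rewrite -mem_enum tE mem_cat mem_head orbT.
  have := m_le x xN; rewrite -/h -/N -/(P x) -/(m x).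
  have := congr1 size tE; rewrite -cardE size_cat /= => sz mx.
  have := leq_mul dN (leqnn Delta).
  have : #|N| * Delta = #|N| * Delta.-1 + #|N| by rewrite addnC -mulnS prednK //; lia.
  rewrite mulSn; lia.
have {dv dN} NE : #|N| = d by apply/eqP; rewrite eqn_leq dv dN.
have [/exists_inP[x xN full]|/exists_inPn nfull] :=
  boolP [exists x in N, #|N| * Delta.-1 <= m x].
  have [Px PN] := family_full P_le xN full.
  apply: Or32; exists N, (neigh h x); split=> //.
    by rewrite h_deg // Px; lia.
  move=> y yN; rewrite (@neigh_induced_eq S) -/h; first by rewrite !hP // PN.
  by rewrite h_deg // PN // Px; lia.
(* A vertex [x] with defect at least 2 is colored last, after [d - 1] others. The others have defect
   at least 1 and at most [d - 2] predecessors, so each vertex meets at most [d * Delta - 3]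
   forbidden colors. *)
have [/exists_inP[x xN low]|/exists_inPn nlow] :=
  boolP [exists x in N, (m x).+1 < #|N| * Delta.-1].
  have us : uniq (rcons (enum (N :\ x)) x).
    by rewrite rcons_uniq enum_uniq mem_enum !inE eqxx.
  apply: Or31; apply: (ext _ us) => [y|t y u tE].
    by rewrite mem_rcons inE mem_enum in_setD1; case: eqVneq => [->|].
  have sz : size t + size u = #|N|.-1.
    have := congr1 size tE; rewrite size_rcons size_cat /= -cardE.
    by rewrite (cardsD1 x N) xN; lia.
  rewrite -/h -/N -/(P y) -/(m y).
  case/lastP: u tE sz => [|u z] tE sz.
    rewrite -cats1 in tE; have /eqP := tE; rewrite -[t ++ _]/(t ++ [:: y]).
    rewrite !cats1 eqseq_rcons => /andP[_ /eqP <-].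
    by move: low sz; rewrite /= NE; nia.
  have yN : y \in N.
    have : y \in rcons (enum (N :\ x)) x by rewrite tE mem_cat mem_head orbT.
    by rewrite mem_rcons inE mem_enum in_setD1 => /predU1P[->|/andP[]].
  by have := nfull y yN; rewrite size_rcons in sz; move: sz; rewrite NE; nia.
apply: Or33.
have near : {in N, forall x, #|N| * Delta.-1 = (m x).+1}.
  by move=> x xN; have := nfull x xN; have := nlow x xN; lia.
have [|x [y [Nxy xy Px Py Pxy]]] := family_near_full P_le _ near.
  by rewrite NE.
split; first by rewrite -NE Nxy cards2 xy.
have [xN yN] : x \in N /\ y \in N by rewrite Nxy !inE !eqxx orbT.
have hx : #|neigh h x| = Delta by rewrite h_deg // Px; lia.
have hy : #|neigh h y| = Delta by rewrite h_deg // Py; lia.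
exists x, y; rewrite !(@neigh_induced_eq S) //; split=> //.
(* The common neighbors are [v] and the [Delta - 2] elements of [P x :&: P y]. *)
rewrite -/h !hP // -setUIr cardsU1 !inE eqxx /=; lia.
Qed.

End Dichotomy.

(** * The bipartite obstruction and the conclusion *)

(** Two edges between [N] and [Y] share an end or are opposite in the 4-cycle [x y x' y'], so all
    their colors differ. *)
Lemma pair_coloring_complete_bipartite (T : finType) (e : rel T) (k : nat) c
    (N Y : {set T}) :
  symmetric e -> irreflexive e -> pair_coloring e k c ->
  {in N, forall w, neigh e w = Y} -> #|N| * #|Y| <= k.
Proof.
move=> e_sym e_irr [c_sym c_lt c_prop c_C4] NY.
have eN x y : x \in N -> y \in Y -> e x y by move=> /NY <-; rewrite inE.
rewrite -cardsX cardE -(size_iota 0 k) -(size_map (fun p => c p.1 p.2)).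
apply: uniq_leq_size => [|a /mapP[[x y]]]; last first.
  by rewrite mem_enum inE /= mem_iota => /andP[xN yY] ->; rewrite c_lt ?eN.
rewrite map_inj_in_uniq ?enum_uniq // => -[x y] [x' y'].
rewrite !mem_enum !inE /= => /andP[xN yY] /andP[xN' yY'] /eqP cE.
have [xx|xx] := eqVneq x x'; have [yy|yy] := eqVneq y y'.
- by rewrite xx yy.
- by rewrite -xx (negPf (c_prop _ _ _ _ _ yy)) ?eN in cE.
- by rewrite -yy ![c _ y]c_sym (negPf (c_prop _ _ _ _ _ xx)) // e_sym eN in cE.
suff: c x y != c x' y' by rewrite cE.
by apply: c_C4 => //; first [exact: eN|rewrite e_sym; exact: eN].
Qed.

Theorem corollary2p5 (d Delta : nat) (T : finType) (e : rel T)
  (e_sym : symmetric e) (e_irr : irreflexive e)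
  (d_ge2 : 2 <= d) (d_le_Delta : d <= Delta)
  (e_degenerate : degenerate d e) (e_max_deg : max_deg e <= Delta)
  (e_qB : qB e = d * Delta - 1) :
  (exists (X Y : {set T}) (u : T),
     [/\ u \notin X, #|X| = d - 1, #|Y| = Delta
       & forall x, x \in X -> neigh e x = Y] /\
     (#|Y :\: neigh e u| = 1 /\ #|neigh e u :\: Y| <= 1) /\
     (forall x x', x \in X -> x' \in X -> x != x' -> false_twins e x x') /\
     (forall x, x \in X -> deg e x = Delta)) /\
  contains_copy (complete_bipartite d (Delta - 1)) e.
Proof.
have [col min] : B_colorable e (d * Delta - 1) /\
    forall k, B_colorable e k -> d * Delta - 1 <= k.
  by rewrite -e_qB /qB; case: ex_minnP.
case: (induced_colorable_or e_sym e_irr d_ge2 d_le_Delta e_degenerate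
    e_max_deg setT) => [[c c_col]|[N [Y [Nd YD NY]]]|[d2 [w [u [wu wD uD wuD]]]]].
- have {}c_col : pair_coloring e (d * Delta - 2) c.
    have eE x y : induced setT e x y = e x y by rewrite /induced /= !in_setT.
    case: c_col => c1 c2 c3 c4; split=> // [x y|x y z|x y z w].
    - by have := c2 x y; rewrite !eE.
    - by have := c3 x y z; rewrite !eE.
    - by have := c4 x y z w; rewrite !eE.
  by have := min _ (pair_coloring_B_colorable e_sym c_col); nia.
- have [c c_col] := B_colorable_pair_coloring e_irr col.
  by have := pair_coloring_complete_bipartite e_sym e_irr c_col NY; rewrite Nd YD; nia.
split.
  (* Since [d - 1 = 1], [X] is a singleton and the false-twin clause is vacuous. Each of the two
     neighborhoods has one element outside the other. *)
  exists [set w], (neigh e w), u; rewrite inE eq_sym wu cards1 d2; split.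
    by split=> // x /set1P ->.
  split; first by rewrite !cardsD setIC [_ :&: neigh e w]setIC; lia.
  split; last by move=> x /set1P ->.
  by move=> x x' /set1P -> /set1P ->; rewrite eqxx.
set Z := neigh e w :&: neigh e u in wuD.
have ZE : #|Z| = Delta - 1 by lia.
(* As [d = 2], the left indices are 0 and 1, sent to [w] and [u]; the right side enumerates their
   common neighbors. *)
pose f (a : 'I_d + 'I_(Delta - 1)) : T := match a with
  | inl i => if val i == 0 then w else u
  | inr j => enum_val (cast_ord (esym ZE) j) end.
have fZ j : f (inr j) \in Z by apply: enum_valP.
have ef i j : e (f (inl i)) (f (inr j)).
  by have := fZ j; rewrite !inE => /andP[] /=; case: ifP.
have fne i j : f (inl i) <> f (inr j).
  by move=> E; have := ef i j; rewrite E e_irr.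
exists f => [|[i|j] [i'|j']] //= ; last by move=> _; rewrite e_sym ef.
  move=> [i|j] [i'|j'] E.
  - congr inl; apply/val_inj; have := ltn_ord i; have := ltn_ord i'.
    move: E => /=; case: eqP => [->|i0]; case: eqP => [->|i0'] //.
    + by move=> E; rewrite E eqxx in wu.
    + by move=> E; rewrite E eqxx in wu.
    by lia.
  - by case: (fne _ _ E).
  - by case: (fne _ _ (esym E)).
  by congr inr; apply: cast_ord_inj (enum_val_inj E).
by move=> _; apply: ef.
Qed.
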